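(* For every complete 4-partite graph $G$ on at least five vertices, $\tau(G)\le\frac{3}{2}\nu(G)$. Moreover, this bound is tight: there is a complete 4-partite graph $G$ (namely the one on $5$ vertices) with $\tau(G)=\frac{3}{2}\nu(G)$.
   Context: A complete 4-partite graph $G=(A,B,C,D,E(G))$ is a graph whose vertex set is partitioned into four nonempty independent sets $A,B,C,D$ such that any two vertices in different parts are adjacent. $\tau(G)$ is the minimum size of a set of edges whose removal leaves a triangle-free graph, and $\nu(G)$ is the maximum number of pairwise edge-disjoint triangles in $G$. *)

(* Defs.v *)
From mathcomp Require Import all_boot.

Set Implicit Arguments.
Unset Strict Implicit.
Unset Printing Implicit Defensive.

Record sgraph := SGraph {
  vertex :> finType;
  adj : rel vertex;
  adj_sym : symmetric adj;
  adj_irr : irreflexive adj }.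

Section Graph.
Variable G : sgraph.
Implicit Types (F X : {set {set G}}) (K L S : {set G}).

(* An edge is the unordered pair of its ends. *)
Definition edges : {set {set G}} :=
  [set S : {set G} | [exists x : G, exists y : G,
                        adj x y && (S == [set x; y])]].

Definition pairs K : {set {set G}} :=
  [set S : {set G} | (S \subset K) && (#|S| == 2)].

(* The spanning subgraph with edge set F is represented by F itself; a triangle
   is represented by its set of three vertices, its edges being the pairs of
   these vertices. *)
Definition triangles F : {set {set G}} :=
  [set K : {set G} | (#|K| == 3) && (pairs K \subset F)].

Definition triangle_free F : bool := triangles F == set0.

Definition triangle_cover X : bool :=
  (X \subset edges) && triangle_free (edges :\: X).

Definition triangle_packing (P : {set {set G}}) : bool :=
  (P \subset triangles edges) &&
  [forall K in P, forall L in P, (K != L) ==> [disjoint pairs K & pairs L]].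

(* The default [edges] is itself a cover, by [triangle_cover_edges] below. *)
Definition tau : nat := #|[arg min_(X < edges | triangle_cover X) #|X|]|.

Definition nu : nat :=
  \max_(P : {set {set G}} | triangle_packing P) #|P|.

Lemma triangle_cover_edges : triangle_cover edges.
Proof.
rewrite /triangle_cover subxx /= setDv; apply/eqP/setP => K.
rewrite !inE; apply/negbTE/negP => /andP[/eqP K3]; rewrite subset0 => /eqP p0.
have [x Kx] : exists x, x \in K by apply/card_gt0P; rewrite K3.
have K2 : #|K :\ x| == 2 by move: K3; rewrite (cardsD1 x) Kx add1n => -[->].
by have := in_set0 (K :\ x); rewrite -p0 inE subD1set K2.
Qed.

Lemma tau_min X : triangle_cover X -> tau <= #|X|.
Proof.
by rewrite /tau; case: arg_minnP => [|Y _ minY /minY]; first exact: triangle_cover_edges.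
Qed.

Lemma tau_attained : exists2 X, triangle_cover X & #|X| = tau.
Proof.
by rewrite /tau; case: arg_minnP => [|Y cY _]; [exact: triangle_cover_edges | exists Y].
Qed.

Definition independent S : Prop := {in S &, forall x y, ~~ adj x y}.

(* [partition] requires the blocks to be nonempty. *)
Definition complete_4partite : Prop :=
  exists P : {set {set G}},
    [/\ partition P [set: G], #|P| = 4,
        {in P, forall S, independent S} &
        {in P &, forall S1 S2, S1 != S2 -> {in S1 & S2, forall x y, adj x y}}].

End Graph.

(* Main.v *)
(* Let the parts have sizes a >= b >= c >= d. Making the graph bipartite along
   the cuts AD|BC and A|BCD gives tau <= min (ad + bc, bc + bd + cd). For nu, a
   Latin rectangle on disjoint, mutually complete classes X, Y, Z with
   |X|, |Y| <= |Z| packs |X||Y| triangles. If a >= c + d, the classes B, C u D, A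
   give b(c + d) triangles, which is enough; otherwise A, B, C u D give ab, which
   is enough unless 3ab < 2(ad + bc). In the remaining, nearly balanced, range
   halve every part and decompose the octahedral graph K_{2,2,2,2} on the halves
   into eight edge-disjoint triangles: the eight Latin rectangles obtained by
   blowing up these triangles together pack about (bc + bd + 2cd)/2 triangles,
   which exceeds the target by more than what rounding the halves can lose. *)

Require Import Defs.
From mathcomp Require Import all_boot all_order all_algebra.
From mathcomp Require Import zify lra.

Set Implicit Arguments.
Unset Strict Implicit.
Unset Printing Implicit Defensive.

(** * Preliminaries on finite sets and Latin rectangles *)

Lemma set2_eq (T : finType) (x y u v : T) :
  [set x; y] = [set u; v] -> (u = x /\ v = y) \/ (u = y /\ v = x) \/ x = y \/ u = v.
Proof.
move=> E.
have /set2P : u \in [set x; y] by rewrite E set21.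
have /set2P : v \in [set x; y] by rewrite E set22.
by case=> ->; case=> ->; auto.
Qed.

Lemma cards3_set3 (T : finType) (K : {set T}) : #|K| == 3 ->
  exists x y z, [/\ x != y, x != z, y != z & K = [set x; y; z]].
Proof.
move=> /eqP K3; have /card_gt0P[x Kx] : 0 < #|K| by rewrite K3.
have /cards2P[y [z [yz E]]] : #|K :\ x| == 2.
  by move: K3; rewrite (cardsD1 x) Kx add1n => -[->].
have : x \notin K :\ x by rewrite setD11.
rewrite E !inE negb_or => /andP[xy xz].
by exists x, y, z; rewrite -setUA -E setD1K.
Qed.

(** Cyclic construction: the entry at (x, y) has index the sum of the two positions modulo [#|Z|].
    All positions lie below [#|Z|], so rows and columns do not repeat. *)
Lemma latin_rectangle (T : finType) (X Y Z : {set T}) :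
  #|X| <= #|Z| -> #|Y| <= #|Z| -> 0 < #|Z| ->
  exists L : T -> T -> T,
    [/\ {in X & Y, forall x y, L x y \in Z},
        {in X, forall x, {in Y &, injective (L x)}} &
        {in Y, forall y, {in X &, injective (L ^~ y)}}].
Proof.
move=> XZ YZ Z0; have [z0 _] := card_gt0P Z0.
pose L x y := nth z0 (enum Z) ((index x (enum X) + index y (enum Y)) %% #|Z|).
have lt x y : (index x (enum X) + index y (enum Y)) %% #|Z| < size (enum Z).
  by rewrite -cardE ltn_mod.
have iX x : x \in X -> index x (enum X) < #|X| by rewrite cardE index_mem mem_enum.
have iY x : x \in Y -> index x (enum Y) < #|Y| by rewrite cardE index_mem mem_enum.
have inj (W : {set T}) x y : x \in W -> y \in W -> index x (enum W) = index y (enum W) -> x = y.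
  by move=> xW yW E; rewrite -(nth_index z0 (_ : x \in enum W)) ?mem_enum // E nth_index ?mem_enum.
exists L; split.
- by move=> x y _ _; rewrite -mem_enum mem_nth.
- move=> x _ y y' yY y'Y /eqP; rewrite /L nth_uniq ?enum_uniq // eqn_modDl.
  by rewrite !modn_small ?(leq_trans (iY _ _)) // => /eqP; exact: inj.
- move=> y _ x x' xX x'X /eqP; rewrite /L nth_uniq ?enum_uniq // eqn_modDr.
  by rewrite !modn_small ?(leq_trans (iX _ _)) // => /eqP; exact: inj.
Qed.

Definition cross (T : finType) (X Y : {set T}) : {set {set T}} :=
  [set [set x; y] | x in X, y in Y].

Lemma card_cross (T : finType) (X Y : {set T}) : #|cross X Y| <= #|X| * #|Y|.
Proof. by rewrite /cross curry_imset2X -cardsX leq_imset_card. Qed.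

Lemma mem_cross (T : finType) (X Y : {set T}) x y :
  (x \in X) && (y \in Y) || (y \in X) && (x \in Y) -> [set x; y] \in cross X Y.
Proof.
case/orP=> /andP[xX yY]; apply/imset2P; first by exists x y.
by exists y x; rewrite // setUC.
Qed.

(** * Triangle packings inside a given set of edges *)

Section Packings.
Variable G : sgraph.
Implicit Types (F Y P : {set {set G}}) (K S : {set G}).

(** A lower bound on the packing number of the subgraph [F]. No maximum is involved, so such bounds
    simply add over disjoint edge sets. *)
Definition packs F (n : nat) : Prop :=
  exists P : {set {set G}},
    [/\ P \subset triangles F,
        {in P &, forall K L, K != L -> [disjoint pairs K & pairs L]} &
        n <= #|P|].

Lemma packs0 F : packs F 0.
Proof. by exists set0; split=> // [|K L]; rewrite ?sub0set ?inE. Qed.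

Lemma packs_nu F n : F \subset edges G -> packs F n -> n <= nu G.
Proof.
move=> sF [P [sP dP nP]]; apply: leq_trans nP _.
rewrite /nu; apply: (@leq_bigmax_cond _ _ (fun P : {set {set G}} => #|P|)).
apply/andP; split.
  apply: subset_trans sP _; apply/subsetP => K; rewrite !inE => /andP[-> /=].
  by move=> /subset_trans; apply.
apply/forall_inP => K KP; apply/forall_inP => L LP; apply/implyP; exact: dP.
Qed.

Lemma pairs_inhab K : #|K| = 3 -> exists S, S \in pairs K.
Proof.
move=> K3; have /card_gt0P[x Kx] : 0 < #|K| by rewrite K3.
exists (K :\ x); rewrite inE subD1set /=.
by move: K3; rewrite (cardsD1 x) Kx add1n => -[->].
Qed.

Lemma packsW F m n : m <= n -> packs F n -> packs F m.
Proof. by move=> mn [P [sP dP nP]]; exists P; split=> //; exact: leq_trans nP. Qed.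

Lemma packsU F1 F2 n1 n2 :
  [disjoint F1 & F2] -> packs F1 n1 -> packs F2 n2 -> packs (F1 :|: F2) (n1 + n2).
Proof.
move=> dF [P1 [s1 d1 c1]] [P2 [s2 d2 c2]].
have sub i F P : P \subset triangles F -> i \in P -> #|i| = 3 /\ pairs i \subset F.
  by move=> /subsetP s /s; rewrite inE => /andP[/eqP].
have cross K L : K \in P1 -> L \in P2 -> [disjoint pairs K & pairs L].
  move=> /(sub _ _ _ s1)[_ sK] /(sub _ _ _ s2)[_ sL].
  exact: disjointWl sK (disjointWr sL dF).
exists (P1 :|: P2); split.
- apply/subsetP => K; rewrite !inE => /orP[/(sub _ _ _ s1)|/(sub _ _ _ s2)] [-> sK] /=.
  + exact: subset_trans sK (subsetUl _ _).
  + exact: subset_trans sK (subsetUr _ _).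
- move=> K L; rewrite !inE => /orP[KP|KP] /orP[LP|LP] KL; first exact: d1.
  + exact: cross.
  + by rewrite disjoint_sym; exact: cross.
  + exact: d2.
- rewrite cardsU (_ : P1 :&: P2 = set0) ?cards0 ?subn0 ?leq_add //.
  (* A triangle in both packings would have its pairs disjoint from themselves, yet it has a
     pair. *)
  apply/setP => K; rewrite !inE; apply/negP => /andP[K1 K2].
  have [/pairs_inhab[S SK] _] := sub _ _ _ s1 K1.
  by have /pred0P/(_ S) := cross K K K1 K2; rewrite /= SK.
Qed.

End Packings.

(** * Edge-disjoint blocks of a labelled vertex set *)

Section Blocks.
Variables (G : sgraph) (lab : G -> nat).
Implicit Types (t : seq nat) (i j k : nat).

Definition class i : {set G} := [set x | lab x == i].

(** The edge set of the complete multipartite graph on the classes labelled by [t]. *)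
Definition block t : {set {set G}} :=
  [set S | [exists x, exists y, [&& S == [set x; y], lab x != lab y,
                                   lab x \in t & lab y \in t]]].

Lemma block_pair t x y :
  lab x != lab y -> lab x \in t -> lab y \in t -> [set x; y] \in block t.
Proof.
by move=> xy tx ty; rewrite inE; apply/existsP; exists x; apply/existsP; exists y;
  rewrite eqxx xy tx ty.
Qed.

Lemma blockP t S :
  S \in block t ->
  exists x y, [/\ S = [set x; y], lab x != lab y, lab x \in t & lab y \in t].
Proof.
by rewrite inE => /existsP[x /existsP[y /and4P[/eqP-> xy tx ty]]]; exists x, y.
Qed.

Lemma block_sub_edges t :
  (forall x y, lab x != lab y -> lab x \in t -> lab y \in t -> adj x y) ->
  block t \subset edges G.
Proof.
move=> adjt; apply/subsetP => S /blockP[x [y [-> xy tx ty]]].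
by rewrite inE; apply/existsP; exists x; apply/existsP; exists y; rewrite adjt ?eqxx.
Qed.

(** A common edge would have two distinct end labels, both lying in [t] and in [t']. *)
Lemma block_disjoint t t' :
  uniq t -> count [in t'] t <= 1 -> [disjoint block t & block t'].
Proof.
move=> ut ct; apply/pred0P => S /=; apply/negP => /andP[/blockP[x [y [-> xy tx ty]]]].
move=> /blockP[u [v [/set2_eq E uv tu tv]]].
have [xt' yt'] : lab x \in t' /\ lab y \in t'.
  case: E => [[<- <-]|[[<- <-]|[xy'|uv']]] //.
    by rewrite xy' eqxx in xy.
  by rewrite uv' eqxx in uv.
suff: 1 < count [in t'] t by rewrite ltnNge ct.
rewrite -size_filter -[2]/(size [:: lab x; lab y]); apply: uniq_leq_size.
  by rewrite /= inE xy.
by move=> i; rewrite !inE mem_filter => /orP[] /eqP->; rewrite ?xt' ?yt' ?tx ?ty.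
Qed.

(** The first two hypotheses are boolean tests on label lists, so for concrete lists they hold by
    computation. *)
Lemma packs_blocks (ts : seq (seq nat * nat)) :
  all (fun u => uniq u.1) ts ->
  pairwise (fun u v => count [in v.1] u.1 <= 1) ts ->
  {in ts, forall u, packs (block u.1) u.2} ->
  packs (\bigcup_(u <- ts) block u.1) (\sum_(u <- ts) u.2).
Proof.
elim: ts => [|u ts IH] /=; first by rewrite !big_nil => *; exact: packs0.
move=> /andP[ut us] /andP[tts pw] pk; rewrite !big_cons; apply: packsU.
- rewrite disjoint_sym; apply/pred0P => S /=; apply/negP => /andP[].
  rewrite big_tnth => /bigcupP[i _ Si] St.
  have /(allP tts) := mem_tnth i (in_tuple ts) => /(block_disjoint ut) /pred0P/(_ S).
  by rewrite /= St Si.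
- by apply: pk; rewrite inE eqxx.
- by apply: IH => // v tsv; apply: pk; rewrite inE tsv orbT.
Qed.

(** The triangles are x, y, [L x y]. By the Latin property any two vertices determine the triangle,
    so no two triangles share an edge. Only inclusion in [t] is asked, which leaves free which label
    plays the part of the largest class [k]. *)
Lemma packs_latin t i j k :
  i != j -> i != k -> j != k -> {subset [:: i; j; k] <= t} ->
  #|class i| <= #|class k| -> #|class j| <= #|class k| ->
  packs (block t) (#|class i| * #|class j|).
Proof.
move=> ij ik jk sub leik lejk.
have [Z0|Zpos] := posnP #|class k|.
  by move: leik; rewrite Z0 leqn0 => /eqP->; exact: packs0.
have [L [LZ Lr Lc]] := latin_rectangle leik lejk Zpos.
pose tri (p : G * G) : {set G} := [set p.1; p.2; L p.1 p.2].
pose XY := setX (class i) (class j).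
have XYin p : p \in XY -> p.1 \in class i /\ p.2 \in class j by case: p => x y /setXP.
have XYP p : p \in XY -> [/\ lab p.1 = i, lab p.2 = j & lab (L p.1 p.2) = k].
  move=> /XYin[p1 p2]; have := LZ _ _ p1 p2.
  by move: p1 p2; rewrite !inE => /eqP-> /eqP-> /eqP->.
(* A vertex of a triangle is recovered from its label. *)
have tri_at p u : p \in XY -> u \in tri p ->
    u = (if lab u == i then p.1 else if lab u == j then p.2 else L p.1 p.2).
  move=> /XYP[p1 p2 p3]; rewrite !inE -orbA => /or3P[] /eqP->.
  - by rewrite p1 eqxx.
  - by rewrite p2 eqxx eq_sym (negbTE ij).
  - by rewrite p3 eq_sym (negbTE ik) eq_sym (negbTE jk).
have share p q u v : p \in XY -> q \in XY -> u != v ->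
    u \in tri p -> u \in tri q -> v \in tri p -> v \in tri q -> p = q.
  move=> pXY qXY uv up uq vp vq.
  have [p1 p2] := XYin _ pXY; have [q1 q2] := XYin _ qXY.
  have := tri_at _ _ qXY vq; have := tri_at _ _ qXY uq.
  have := tri_at _ _ pXY vp; have := tri_at _ _ pXY up.
  case: p q {up uq vp vq pXY qXY} p1 p2 q1 q2 => [x y] [x' y'] /= xi yj xi' yj'.
  (* Two vertices with the same label coincide; otherwise two of x, y, [L x y] are known, and row or
     column injectivity gives the third. *)
  case: (lab u == i); case: (lab v == i); case: (lab u == j); case: (lab v == j);
    move=> eu ev eu' ev';
    try (by rewrite eu ev eqxx in uv);
    move: eu' ev'; rewrite eu ev => E1 E2; subst=> //;
    do ?[by move/(Lr _ xi' _ _ yj yj') : E2 => ->| by move/(Lr _ xi' _ _ yj yj') : E1 => ->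
        |by move/(Lc _ yj' _ _ xi xi') : E2 => ->| by move/(Lc _ yj' _ _ xi xi') : E1 => ->].
have card3 p : p \in XY -> #|tri p| = 3.
  move=> /XYP[p1 p2 p3]; have ne u v : lab u != lab v -> u != v.
    by apply: contraNneq => ->.
  rewrite /tri -setUA cardsU1 cards2 !inE !negb_or !ne ?p1 ?p2 ?p3 //.
exists (tri @: XY); split.
- apply/subsetP => _ /imsetP[p pXY ->]; rewrite inE card3 //=.
  apply/subsetP => S; rewrite inE => /andP[sS /cards2P[u [v [uv eS]]]].
  have [up vp] : u \in tri p /\ v \in tri p.
    by split; apply: (subsetP sS); rewrite eS !inE eqxx ?orbT.
  have [p1 p2 p3] := XYP _ pXY.
  have labt w : w \in tri p -> lab w \in t.
    by rewrite !inE -orbA => /or3P[] /eqP->; rewrite ?p1 ?p2 ?p3; apply: sub;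
       rewrite !inE eqxx ?orbT.
  rewrite eS; apply: block_pair; [|exact: labt..].
  by apply: contraNneq uv => E; rewrite (tri_at _ _ pXY up) (tri_at _ _ pXY vp) E.
- move=> _ _ /imsetP[p pXY ->] /imsetP[q qXY ->] npq.
  apply/pred0P => S /=; apply/negP => /andP[].
  rewrite !inE => /andP[sp /cards2P[u [v [uv eS]]]] /andP[sq _].
  suff E : p = q by rewrite E eqxx in npq.
  by apply: (share p q u v) => //; apply: (subsetP sp) || apply: (subsetP sq);
     rewrite eS !inE eqxx ?orbT.
- rewrite card_in_imset ?cardsX // => p q pXY qXY E.
  apply: (share p q p.1 p.2) => //; rewrite -?E ?inE ?eqxx ?orbT //.
  have [p1 p2 _] := XYP _ pXY.
  by apply: contraNneq ij => e; rewrite -p1 -p2 e.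
Qed.

End Blocks.

(** * Arithmetic: eight rectangles on rounded halves reach the target *)

Lemma block_bound_gt (a b c d b1 b2 c1 c2 d1 d2 : nat) :
  b < a -> c <= b -> d <= c -> 0 < d -> a < c + d ->
  3 * (a * b) < 2 * (a * d + b * c) ->
  b = b1 + b2 -> c = c1 + c2 -> d = d1 + d2 ->
  b1 <= b2 <= b1.+1 -> c1 <= c2 <= c1.+1 -> d1 <= d2 <= d1.+1 ->
  2 * (a * d + b * c) <=
  3 * (b2 * c2 + b1 * c1 + b1 * d2 + b2 * d1 + c1 * d1 + c2 * d2 + c1 * d2 + c1 * d1).
Proof.
move=> ba cb dc d0 acd reg eB eC eD lb lc ld.
have cd : c < 2 * d by nia.
pose T := b2 * c2 + b1 * c1 + b1 * d2 + b2 * d1 + c1 * d1 + c2 * d2 + c1 * d2 + c1 * d1.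
(* Without rounding, [2 * T] would be [b * c + b * d + 2 * (c * d)]. *)
have T2 : b * c + b * d + 2 * (c * d) <= 2 * T + d.
  have : (b2 = b1 \/ b2 = b1.+1) /\ (c2 = c1 \/ c2 = c1.+1) /\ (d2 = d1 \/ d2 = d1.+1).
    by lia.
  clear reg cd acd ba; rewrite /T; subst b c d.
  by case=> -[eb|eb] [[ec|ec] [ed|ed]]; subst b2 c2 d2; nia.
(* Since [a + 1 <= c + d], it suffices that bc + 4d^2 <= 3bd + 2cd. With u = c - d and v = b - c the
   difference is 3du + 2dv - u^2 - uv, nonnegative for u <= d. *)
have S : 4 * (a * d) + b * c + 4 * d <= 3 * (b * d) + 6 * (c * d).
  have [u eu] : exists u, c = d + u by exists (c - d); lia.
  have [v ev] : exists v, b = c + v by exists (b - c); lia.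
  have ud : u <= d by lia.
  have h1 : u * u <= d * u by rewrite leq_mul2r ud orbT.
  have h2 : u * v <= d * v by rewrite leq_mul2r ud orbT.
  have h3 : (a + 1) * d <= (c + d) * d by rewrite leq_mul2r addn1 acd orbT.
  clear - h1 h2 h3 eu ev; subst b c; lia.
rewrite -/T; lia.
Qed.

(** The case a = b. Compared with a > b, the products b2 d1 and c2 d2 drop to b1 d1 and c1 d2, so
    the halves of d enter only through their sum. Rounding may now lose 3d; this is absorbed using
    [3 * d <= d * d], hence the separate treatment of d = 2. *)
Lemma block_bound_eq (b c d b1 b2 c1 c2 : nat) :
  c <= b -> d <= c -> 1 < d -> b < c + d ->
  3 * (b * b) < 2 * (b * d + b * c) ->
  b = b1 + b2 -> c = c1 + c2 -> b1 <= b2 <= b1.+1 -> c1 <= c2 <= c1.+1 ->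
  2 * (b * d + b * c) <= 3 * (b2 * c2 + b1 * c1 + b1 * d + 2 * (c1 * d)).
Proof.
move=> cb dc d0 acd reg eB eC lb lc.
have reg' : 3 * b < 2 * (c + d) by nia.
have [d2|d3] := leqP d 2.
  have ed : d = 2 by lia.
  have [eb1 ec1] : b1 = 1 /\ c1 = 1 by lia.
  have [[eb2 ec2]|[eb2 ec2]] : b2 = 1 /\ c2 = 1 \/ b2 = 2 /\ c2 = 2 by lia.
    by subst.
  by subst.
pose T := b2 * c2 + b1 * c1 + b1 * d + 2 * (c1 * d).
have T2 : b * c + b * d + 2 * (c * d) <= 2 * T + 3 * d.
  have : (b2 = b1 \/ b2 = b1.+1) /\ (c2 = c1 \/ c2 = c1.+1) by lia.
  clear reg reg' acd; rewrite /T; subst b c.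
  by case=> -[eb|eb] [ec|ec]; subst b2 c2; nia.
have S : 4 * (b * d) + b * c + 9 * d <= 3 * (b * d) + 6 * (c * d).
  have [u eu] : exists u, c = d + u by exists (c - d); lia.
  have [v ev] : exists v, b = c + v by exists (b - c); lia.
  (* This is [reg'] written in d, u, v. *)
  have uvd : u + 3 * v <= d by lia.
  have h1 : 3 * d <= d * d by rewrite leq_mul2r d3 orbT.
  have h2 : (u + v) * u <= d * u by rewrite leq_mul2r (_ : _ + _ <= _) ?orbT //; lia.
  have h3 : (3 * v) * d <= d * d by rewrite leq_mul2r (_ : _ * _ <= _) ?orbT //; lia.
  clear - h1 h2 h3 eu ev; subst b c; lia.
rewrite -/T; lia.
Qed.

(** * Triangle covers from cuts *)

Lemma adj_of_edge (G : sgraph) (x y : G) : x != y -> [set x; y] \in edges G -> adj x y.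
Proof.
move=> xy; rewrite inE => /existsP[u /existsP[v /andP[uv /eqP/set2_eq E]]].
case: E uv => [[-> ->]|[[-> ->]|[E|->]]] //; first by rewrite adj_sym.
  by rewrite E eqxx in xy.
by rewrite adj_irr.
Qed.

(* Deleting the edges inside the two sides of a cut leaves a bipartite graph. *)
Lemma tau_cut (G : sgraph) (side : pred G) (Y : {set {set G}}) :
  (forall x y, adj x y -> side x = side y -> [set x; y] \in Y) -> tau G <= #|Y|.
Proof.
(* [Y] may contain non-edges, so the cover is its intersection with the edge set. *)
move=> sY; apply: leq_trans (subset_leq_card (subsetIr (edges G) Y)).
apply: tau_min; rewrite /triangle_cover subsetIl /=; apply/eqP/setP => K.
rewrite !inE; apply/negP => /andP[/cards3_set3[x [y [z [xy xz yz ->]]]] /subsetP sub].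
have absurd u v : u \in [set x; y; z] -> v \in [set x; y; z] -> u != v ->
    side u = side v -> False.
  move=> uK vK uv suv.
  have /sub : [set u; v] \in pairs [set x; y; z].
    by rewrite inE cards2 uv; rewrite subUset !sub1set uK vK.
  rewrite in_setD in_setI => /andP[+ euv]; rewrite euv /= sY //.
  exact: adj_of_edge uv euv.
have [xK yK zK] : [/\ x \in [set x; y; z], y \in [set x; y; z] & z \in [set x; y; z]].
  by rewrite !inE !eqxx ?orbT.
(* Two of the three vertices lie on the same side. *)
move: (absurd _ _ xK yK xy) (absurd _ _ xK zK xz) (absurd _ _ yK zK yz).
by case: (side x); case: (side y); case: (side z) => a1 a2 a3;
  first [exact: a1 | exact: a2 | exact: a3].
Qed.

(** * Bounds on [tau] and [nu] for four parts of decreasing size *)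

Section FourParts.
Variables (G : sgraph) (p : G -> nat).
Hypothesis p4 : forall x, p x < 4.
Hypothesis adjE : forall x y, adj x y = (p x != p y).
Let V i := class p i.
Let a := #|V 0|.
Let b := #|V 1|.
Let c := #|V 2|.
Let d := #|V 3|.
Hypotheses (ba : b <= a) (cb : c <= b) (dc : d <= c) (d0 : 0 < d).

Lemma tau_two_two : tau G <= a * d + b * c.
Proof.
apply: leq_trans (leq_add (card_cross (V 0) (V 3)) (card_cross (V 1) (V 2))).
apply: leq_trans (leq_card_setU _ _).
apply: (@tau_cut G (fun x => p x \in [:: 0; 3])) => x y; rewrite adjE => xy.
rewrite in_setU => pxy; apply/orP; move: xy pxy; rewrite !inE.
have := p4 x; have := p4 y => y4 x4 xy pxy.
have [E|E] : (p x = 0 /\ p y = 3 \/ p x = 3 /\ p y = 0) \/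
   (p x = 1 /\ p y = 2 \/ p x = 2 /\ p y = 1) by lia.
- by left; apply: mem_cross; rewrite !inE; lia.
- by right; apply: mem_cross; rewrite !inE; lia.
Qed.

Lemma tau_one_three : tau G <= b * c + b * d + c * d.
Proof.
apply: leq_trans (leq_add (leq_add (card_cross (V 1) (V 2)) (card_cross (V 1) (V 3)))
  (card_cross (V 2) (V 3))).
apply: leq_trans (leq_add (leq_card_setU _ _) (leqnn _)).
apply: leq_trans (leq_card_setU _ _).
apply: (@tau_cut G (fun x => p x == 0)) => x y; rewrite adjE => xy.
rewrite !in_setU => pxy.
have := p4 x; have := p4 y => y4 x4.
have [E|[E|E]] : (p x = 1 /\ p y = 2 \/ p x = 2 /\ p y = 1) \/
   (p x = 1 /\ p y = 3 \/ p x = 3 /\ p y = 1) \/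
   (p x = 2 /\ p y = 3 \/ p x = 3 /\ p y = 2) by lia.
- by apply/orP; left; apply/orP; left; apply: mem_cross; rewrite !inE; lia.
- by apply/orP; left; apply/orP; right; apply: mem_cross; rewrite !inE; lia.
- by apply/orP; right; apply: mem_cross; rewrite !inE; lia.
Qed.

(** Merges the two smallest parts C and D into one class. *)
Let q x := minn (p x) 2.

Lemma card_class_merge :
  [/\ #|class q 0| = a, #|class q 1| = b & #|class q 2| = c + d].
Proof.
split.
- by apply: eq_card => x; rewrite !inE /q; lia.
- by apply: eq_card => x; rewrite !inE /q; lia.
- have -> : class q 2 = V 2 :|: V 3.
    by apply/setP => x; rewrite !inE /q; have := p4 x; lia.
  rewrite cardsU (_ : V 2 :&: V 3 = set0) ?cards0 ?subn0 //.
  by apply/setP => x; rewrite !inE; lia.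
Qed.

Lemma nu_latin i j k :
  i != j -> i != k -> j != k -> i < 3 -> j < 3 -> k < 3 ->
  #|class q i| <= #|class q k| -> #|class q j| <= #|class q k| ->
  #|class q i| * #|class q j| <= nu G.
Proof.
move=> ij ik jk i3 j3 k3 leik lejk.
apply: (@packs_nu _ (block q [:: i; j; k])).
  apply: block_sub_edges => x y qxy _ _; rewrite adjE.
  by apply: contraNneq qxy => E; rewrite /q E.
exact: (@packs_latin _ _ _ i j k).
Qed.

(** A single set halves all parts at once: it takes the first half of the enumeration of each. *)
Lemma halving : exists H : {set G}, forall i, i < 4 ->
  #|V i :&: H| = #|V i|./2 /\ #|V i :\: H| = uphalf #|V i|.
Proof.
pose H := [set x | index x (enum (V (p x))) < #|V (p x)|./2].
exists H => i _.
have VH : #|V i :&: H| = #|V i|./2.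
  rewrite -[RHS](_ : size (take #|V i|./2 (enum (V i))) = _); last first.
    by rewrite size_takel // -cardE; lia.
  rewrite -(card_uniqP (take_uniq _ (enum_uniq _))); apply: eq_card => x.
  rewrite !inE; have [px|npx] := eqVneq (p x) i.
    rewrite in_take_leq -?cardE ?px //; lia.
  apply/esym/negP => /mem_take; rewrite mem_enum inE => E; by rewrite E in npx.
split=> //; rewrite cardsD VH; lia.
Qed.

(** The label triples below partition the 24 edges of K_{2,2,2,2}. Each block yields the product of
    two of its classes, provided the third is at least as large; the orderings that rounding allows
    depend on whether a > b or a = b. *)
Lemma nu_blocks : a < c + d -> 3 * (a * b) < 2 * (a * d + b * c) -> 1 < a ->
  2 * (a * d + b * c) <= 3 * nu G.
Proof.
move=> acd reg a1.
have [H HH] := halving.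
(* Labels 2i and 2i+1: the floor and ceiling halves of part i. *)
pose lab x := 2 * p x + (x \notin H).
pose s i := #|class lab i|.
have sE i : i < 4 -> s (2 * i) = #|V i|./2 /\ s (2 * i).+1 = uphalf #|V i|.
  move=> /HH[<- <-]; split; apply: eq_card => x; rewrite !inE /lab.
    by case: (x \in H) => /=; lia.
  by case: (x \in H) => /=; lia.
have [s0 s1] : s 0 = a./2 /\ s 1 = uphalf a := sE 0 isT.
have [s2 s3] : s 2 = b./2 /\ s 3 = uphalf b := sE 1 isT.
have [s4 s5] : s 4 = c./2 /\ s 5 = uphalf c := sE 2 isT.
have [s6 s7] : s 6 = d./2 /\ s 7 = uphalf d := sE 3 isT.
have blk (t : seq nat) (i j k m : nat) : uniq [:: i; j; k] -> all [in t] [:: i; j; k] ->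
    s i <= s k -> s j <= s k -> m <= s i * s j -> packs (block lab t) m.
  move=> /and3P[]; rewrite !inE negb_or => /andP[ij ik] jk _ /allP sub ik' jk' ms.
  exact: packsW ms (packs_latin ij ik jk sub ik' jk').
(* The third test halves the labels: distinct results mean distinct parts, so edges of a block are
   edges of [G]. *)
have total ts : all (fun t : seq nat * nat => uniq t.1) ts ->
    pairwise (fun t t' : seq nat * nat => count [in t'.1] t.1 <= 1) ts ->
    all (fun t : seq nat * nat => uniq (map half t.1)) ts ->
    {in ts, forall t, packs (block lab t.1) t.2} -> \sum_(t <- ts) t.2 <= nu G.
  move=> u1 u2 u3 /(packs_blocks u1 u2); apply: packs_nu.
  rewrite big_tnth; apply/bigcupsP => i _; apply: block_sub_edges => x y.
  have /(allP u3) := mem_tnth i (in_tuple ts); move: (tnth _ _).1 => t ut.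
  rewrite adjE => xy xt yt; apply: contraNneq xy => E.
  have hlab z : (lab z)./2 = p z by rewrite /lab; case: (z \in H) => /=; lia.
  apply/eqP; rewrite -(nth_index 0 xt) -(nth_index 0 yt); congr nth.
  apply/eqP; rewrite -(nth_uniq 0 _ _ ut) ?size_map ?index_mem //.
  by rewrite !(nth_map 0) ?index_mem // !nth_index // !hlab E.
clear sE HH; clearbody s.
have hs : s 0 <= s 1 <= (s 0).+1 /\ s 2 <= s 3 <= (s 2).+1 /\ s 4 <= s 5 <= (s 4).+1 /\
  s 6 <= s 7 <= (s 6).+1 by lia.
have hm : s 6 <= s 4 <= s 2 /\ s 2 <= s 0 /\ s 7 <= s 5 <= s 3 /\ s 3 <= s 1 by lia.
have [sab|eab] : b < a \/ a = b by lia.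
(* When a > b, even the larger half of B fits into the smaller half of A. *)
- have s03 : s 3 <= s 0 by lia.
  have := total [:: ([:: 1; 3; 5], s 3 * s 5); ([:: 0; 2; 4], s 2 * s 4);
    ([:: 1; 2; 7], s 2 * s 7); ([:: 0; 3; 6], s 3 * s 6); ([:: 1; 4; 6], s 4 * s 6);
    ([:: 0; 5; 7], s 5 * s 7); ([:: 7; 3; 4], s 4 * s 7); ([:: 6; 2; 5], s 4 * s 6)]
    isT isT isT.
  rewrite !big_cons big_nil /= => bound.
  apply: leq_trans (leq_mul (leqnn 3) (bound _)); last first.
    move=> t; rewrite !inE; do 7?[case/orP]; move=> /eqP->; cbn [fst snd].
    + by apply: (blk _ 3 5 1) => //; lia.
    + by apply: (blk _ 2 4 0) => //; lia.
    + by apply: (blk _ 2 7 1) => //; lia.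
    + by apply: (blk _ 3 6 0) => //; lia.
    + by apply: (blk _ 4 6 1) => //; lia.
    + by apply: (blk _ 5 7 0) => //; lia.
    + by apply: (blk _ 4 7 3) => //; lia.
    (* [s 5] exceeds [s 2] exactly when b = c is odd. Both are at least [s 4], so the count
       [s 4 * s 6] is available either way. *)
    + have [l|l] := leqP (s 5) (s 2).
      * by apply: (blk _ 5 6 2) => //; rewrite ?leq_mul2r; lia.
      * by apply: (blk _ 2 6 5) => //; rewrite ?leq_mul2r; lia.
  apply: leq_trans (@block_bound_gt a b c d (s 2) (s 3) (s 4) (s 5) (s 6) (s 7)
    _ _ _ _ _ _ _ _ _ _ _ _) _ => //; lia.
(* If a = b is odd then [s 3 <= s 0] fails, so the block 0, 3, 6 is counted as [s 2 * s 6]; the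
   block 0, 5, 7 is counted as [s 4 * s 7] in case [s 5] exceeds [s 0]. *)
- have e02 : s 0 = s 2 by rewrite s0 s2 eab.
  have := total [:: ([:: 1; 3; 5], s 3 * s 5); ([:: 0; 2; 4], s 2 * s 4);
    ([:: 1; 2; 7], s 2 * s 7); ([:: 0; 3; 6], s 2 * s 6); ([:: 1; 4; 6], s 4 * s 6);
    ([:: 0; 5; 7], s 4 * s 7); ([:: 7; 3; 4], s 4 * s 7); ([:: 6; 2; 5], s 4 * s 6)]
    isT isT isT.
  rewrite !big_cons big_nil /= => bound.
  apply: leq_trans (leq_mul (leqnn 3) (bound _)); last first.
    move=> t; rewrite !inE; do 7?[case/orP]; move=> /eqP->; cbn [fst snd].
    + by apply: (blk _ 3 5 1) => //; lia.
    + by apply: (blk _ 2 4 0) => //; lia.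
    + by apply: (blk _ 2 7 1) => //; lia.
    + by apply: (blk _ 0 6 3) => //; rewrite ?e02; lia.
    + by apply: (blk _ 4 6 1) => //; lia.
    + have [l|l] := leqP (s 5) (s 0).
      * by apply: (blk _ 5 7 0) => //; rewrite ?leq_mul2r; lia.
      * by apply: (blk _ 0 7 5) => //; rewrite ?leq_mul2r; lia.
    + by apply: (blk _ 4 7 3) => //; lia.
    + have [l|l] := leqP (s 5) (s 2).
      * by apply: (blk _ 5 6 2) => //; rewrite ?leq_mul2r; lia.
      * by apply: (blk _ 2 6 5) => //; rewrite ?leq_mul2r; lia.
  have h := @block_bound_eq b c d (s 2) (s 3) (s 4) (s 5).
  (* If d = 1, then 3b < 2(c + d) and c <= b would give b < 2, against [a1]. *)
  have d1 : 1 < d by nia.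
  have ed : d = s 6 + s 7 by lia.
  rewrite eab in reg acd *; apply: leq_trans (h _ _ _ _ _ _ _ _ _) _ => //; try lia.
Qed.

Lemma tau_le_nu : 4 < a + b + c + d -> 2 * tau G <= 3 * nu G.
Proof.
move=> n5; have t1 := tau_two_two; have t2 := tau_one_three.
have [q0 q1 q2] := card_class_merge.
have [cda|acd] := leqP (c + d) a.
  have l : b * (c + d) <= nu G.
    by rewrite -q1 -q2; apply: (@nu_latin 1 2 0) => //; rewrite ?q0 ?q1 ?q2.
  (* With the bound bc + bd + cd on [tau], what remains is 2cd <= bc + bd. *)
  have cdb : c * d <= b * d by rewrite leq_mul2r cb orbT.
  have ccb : c * d <= b * c by rewrite mulnC leq_mul // (leq_trans dc).
  have [abc|bca] := leqP a (b + c); last by lia.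
  have : a * d <= (b + c) * d by rewrite leq_mul2r abc orbT.
  lia.
have [reg|reg] := leqP (2 * (a * d + b * c)) (3 * (a * b)).
  have l : a * b <= nu G.
    by rewrite -q0 -q1; apply: (@nu_latin 0 1 2) => //; rewrite ?q0 ?q1 ?q2; lia.
  lia.
(* Here [1 < a], as four singleton parts make only four vertices. *)
apply: leq_trans (nu_blocks _ _ _) => //; last by lia.
by rewrite leq_mul2l.
Qed.

End FourParts.

(** * From a partition to a labelling *)

(** The parts are sorted by decreasing size, and a vertex is labelled by the position of its
    part. *)
Lemma complete_4partite_parts (G : sgraph) : complete_4partite G ->
  exists p : G -> nat,
    [/\ forall x, p x < 4, forall x y, adj x y = (p x != p y),
        #|class p 1| <= #|class p 0|, #|class p 2| <= #|class p 1| &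
        0 < #|class p 3| <= #|class p 2|].
Proof.
case=> P [/and3P[/eqP covP trivP P0] P4 indP adjP].
pose ge (S T : {set G}) := #|T| <= #|S|.
pose s := sort ge (enum P).
have sP S : (S \in s) = (S \in P) by rewrite mem_sort mem_enum.
have us : uniq s by rewrite sort_uniq enum_uniq.
have ss : size s = 4 by rewrite size_sort -cardE.
pose p (x : G) := find (fun S : {set G} => x \in S) s.
have hasx x : has (fun S : {set G} => x \in S) s.
  have : x \in cover P by rewrite covP inE.
  by case/bigcupP => S SP xS; apply/hasP; exists S; rewrite ?sP.
have p4 x : p x < 4 by rewrite -ss -has_find.
have inp x : x \in nth set0 s (p x) := nth_find set0 (hasx x).
have nthP i : i < 4 -> nth set0 s i \in P by rewrite -ss -sP; exact: mem_nth.
have mem_nthE x i : i < 4 -> (x \in nth set0 s i) = (p x == i).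
  move=> i4; apply/idP/eqP => [xi|<- //].
  apply/eqP; rewrite -(nth_uniq set0 _ _ us) ?ss //; apply/negPn/negP => ne.
  have /trivIsetP/(_ _ _ (nthP _ (p4 x)) (nthP _ i4) ne) := trivP.
  by move=> /pred0P/(_ x); rewrite /= inp xi.
have classE i : i < 4 -> class p i = nth set0 s i.
  by move=> i4; apply/setP => x; rewrite mem_nthE // inE.
have srt i : i.+1 < 4 -> #|class p i.+1| <= #|class p i|.
  move=> i4; rewrite !classE // ?(ltnW i4) //.
  have /(sortedP set0) : sorted ge s by apply: sort_sorted => S T; exact: leq_total.
  by apply; rewrite ss.
exists p; split; rewrite ?srt //.
- move=> x y; have [E|ne] := eqVneq (p x) (p y); last first.
    apply: (adjP _ _ (nthP _ (p4 x)) (nthP _ (p4 y))) => //.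
    by rewrite nth_uniq ?ss.
  apply/negbTE; apply: (indP _ (nthP _ (p4 x))) => //; by rewrite E.
- rewrite andbT classE // card_gt0; apply: contraNneq P0 => <-; exact: nthP.
Qed.

(** * Tightness on five vertices *)

(* K_{2,1,1,1}: the complete graph on five vertices without the edge 01. *)
Definition k2111_adj : rel 'I_5 := fun x y => maxn x 1 != maxn y 1.

Lemma k2111_adj_sym : symmetric k2111_adj.
Proof. by move=> x y; rewrite /k2111_adj eq_sym. Qed.

Lemma k2111_adj_irr : irreflexive k2111_adj.
Proof. by move=> x; rewrite /k2111_adj eqxx. Qed.

Definition k2111 : sgraph := SGraph k2111_adj_sym k2111_adj_irr.

Lemma k2111_4partite : complete_4partite k2111.
Proof.
(* [maxn x 1] takes the values 1 to 4, hence the shift; the vertex [i.+1] represents [B i]. *)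
pose B (i : 'I_4) : {set 'I_5} := [set x : 'I_5 | maxn x 1 == i.+1].
have Bi (i : 'I_4) : inord i.+1 \in B i.
  by rewrite inE inordK; have := ltn_ord i; lia.
have injB : injective B.
  move=> i j E; have := Bi i; rewrite E inE inordK; have := ltn_ord i; last by [].
  by move=> _ /eqP ji; apply: val_inj => /=; lia.
exists [set B i | i : 'I_4]; split.
- apply/and3P; split.
  + apply/eqP/setP => x; rewrite inE; apply/bigcupP.
    have x4 : (maxn x 1).-1 < 4 by case: x => /=; lia.
    by exists (B (Ordinal x4)); rewrite ?imset_f // inE /=; lia.
  + apply/trivIsetP => _ _ /imsetP[i _ ->] /imsetP[j _ ->] ne.
    apply/pred0P => x; rewrite /= !inE; apply/negP => /andP[/eqP-> /eqP ij].
    by move: ne; rewrite (_ : i = j) ?eqxx //; apply: val_inj => /=; lia.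
  + by apply/negP => /imsetP[i _ E]; have := Bi i; rewrite -E inE.
- by rewrite card_imset // card_ord.
- move=> _ /imsetP[i _ ->] x y; rewrite !inE => /eqP xi /eqP yi.
  by rewrite /= /k2111_adj xi yi eqxx.
- move=> _ _ /imsetP[i _ ->] /imsetP[j _ ->] ne x y; rewrite !inE => /eqP xi /eqP yj.
  rewrite /= /k2111_adj xi yj; apply: contraNneq ne => ij; apply/eqP; congr B.
  by apply: val_inj => /=; lia.
Qed.

Lemma triangle_cover_hits (G : sgraph) (X : {set {set G}}) (x y z : G) :
  triangle_cover X -> adj x y -> adj x z -> adj y z ->
  [|| [set x; y] \in X, [set x; z] \in X | [set y; z] \in X].
Proof.
move=> /andP[_ /eqP/setP/(_ [set x; y; z])]; rewrite in_set0 => noK axy axz ayz.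
have ne u v : adj u v -> u != v by apply: contraTneq => ->; rewrite adj_irr.
apply: contraFT noK; rewrite !negb_or => /and3P[xyX xzX yzX].
have [xy xz yz] := And3 (ne _ _ _ axy) (ne _ _ _ axz) (ne _ _ _ ayz).
rewrite inE -setUA cardsU1 cards2 !inE negb_or xy xz yz /=.
(* Both orders of the ends are recorded, to match every case of the final enumeration. *)
have kept u v : adj u v -> [set u; v] \notin X ->
    [set u; v] \in edges G :\: X /\ [set v; u] \in edges G :\: X.
  move=> auv uvX; rewrite [[set v; u]]setUC; suff -> : [set u; v] \in edges G :\: X by [].
  rewrite in_setD uvX inE; apply/existsP; exists u; apply/existsP; exists v.
  by rewrite auv eqxx.
apply/subsetP => S; rewrite inE => /andP[sS /cards2P[u [v [uv ES]]]].
have inK w : w \in S -> [|| w == x, w == y | w == z].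
  by move=> /(subsetP sS); rewrite !inE.
have uK := inK u; have vK := inK v; rewrite ES !inE !eqxx orbT in uK vK.
have [k1 k2] := kept _ _ axy xyX; have [k3 k4] := kept _ _ axz xzX.
have [k5 k6] := kept _ _ ayz yzX.
rewrite ES; case/or3P: (uK isT) uv => /eqP-> + ; case/or3P: (vK isT) => /eqP->;
  by rewrite ?eqxx.
Qed.

(* Two triangles that both contain 0, or both avoid it, live on four common
   vertices, hence share an edge. *)
Lemma k2111_nu : nu k2111 <= 2.
Proof.
apply/bigmax_leqP => P /andP[/subsetP sP /forall_inP dP].
pose v0 : k2111 := (ord0 : 'I_5); pose v1 : k2111 := (inord 1 : 'I_5).
(* The bound 2 is read as the number of booleans: a triangle is sent to whether it contains 0. *)
rewrite -card_bool -[#|{: bool}|]cardsT.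
suff inj : {in P &, injective (fun K : {set k2111} => v0 \in K)}.
  by rewrite -(card_in_imset inj) subset_leq_card // subsetT.
move=> K L KP LP E; apply/eqP/negPn/negP => KL.
have P3 S : S \in P -> #|S| = 3 /\ (v0 \in S) + (v1 \in S) <= 1.
  move=> /sP; rewrite inE => /andP[/eqP S3 /subsetP sS]; split=> //.
  case: (boolP (v0 \in S)) => // S0; case: (boolP (v1 \in S)) => // S1.
  have ne : v0 != v1 by apply/eqP => /(congr1 val) /=; rewrite inordK.
  have : [set v0; v1] \in pairs S by rewrite inE cards2 ne subUset !sub1set S0 S1.
  by move=> /sS /(adj_of_edge ne); rewrite /= /k2111_adj inordK.
(* Triangles containing 0 miss its non-neighbour 1; the others miss 0. *)
have [w KLw] : exists w, K :|: L \subset [set~ w].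
  have sub1 w : w \notin K -> w \notin L -> K :|: L \subset [set~ w].
    by move=> wK wL; apply/subsetP => z; rewrite !inE; apply: contraTneq => ->;
       rewrite negb_or wK wL.
  have [_ K01] := P3 _ KP; have [_ L01] := P3 _ LP; move: E => /= E.
  case K0 : (v0 \in K) in E K01; rewrite -E in L01.
    by exists v1; apply: sub1; apply/negP => v1in; rewrite v1in in K01 L01.
  by exists v0; apply: sub1; rewrite -?E ?K0.
have := subset_leq_card KLw; rewrite cardsC1 card_ord cardsU.
have [-> _] := P3 _ KP; have [-> _] := P3 _ LP => le4.
(* Two triples inside four vertices meet in at least 3 + 3 - 4 = 2 of them. *)
have /card_gt1P[x [y [xKL yKL xy]]] : 1 < #|K :&: L| by lia.
have /forall_inP/(_ L LP)/implyP/(_ KL)/pred0P/(_ [set x; y]) := dP K KP.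
move: xKL yKL; rewrite !inE => /andP[xK xL] /andP[yK yL].
by rewrite /= ?inE cards2 xy !subUset !sub1set xK xL yK yL.
Qed.

(* A cover contains an edge ab of the triangle 234; with c the third vertex, it
   also hits the triangles 0ac and 1bc, and these edges are distinct. *)
Lemma k2111_tau : 3 <= tau k2111.
Proof.
have [X cX <-] := tau_attained k2111.
pose v i : k2111 := (inord i : 'I_5).
have vE i : i < 5 -> v i = i :> nat by move=> i5; rewrite /v inordK.
have adjv i j : i < 5 -> j < 5 -> maxn i 1 != maxn j 1 -> adj (v i) (v j).
  by move=> i5 j5; rewrite /= /k2111_adj !vE.
have neq i j : i < 5 -> j < 5 -> (v i == v j) = (i == j).
  by move=> i5 j5; rewrite -[v i == v j]/(nat_of_ord (v i) == nat_of_ord (v j)) !vE.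
have step a b c : [&& 1 < a < 5, 1 < b < 5 & 1 < c < 5] -> uniq [:: a; b; c] ->
    [set v a; v b] \in X -> 3 <= #|X|.
  move=> bnd; rewrite /= !inE negb_or andbT => /andP[/andP[ab ac] bc] abX.
  (* The memberships kept for [e1] and [e2] separate the three edges: b is not in [e1], a is not in
     [e2], and [e2] contains 1 or b while [e1] contains neither. *)
  have [e1 e1X /andP[i1 b1]] : exists2 e, e \in X & (v 1 \notin e) && (v b \notin e).
    have hit : [|| [set v 0; v a] \in X, [set v 0; v c] \in X | [set v a; v c] \in X].
      by apply: triangle_cover_hits => //; apply: adjv; lia.
    by case/or3P: hit => eX; first [exists [set v 0; v a]; rewrite // !inE !neq; lia
            |exists [set v 0; v c]; rewrite // !inE !neq; lia
            |exists [set v a; v c]; rewrite // !inE !neq; lia].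
  have [e2 e2X /andP[a2 ib2]] : exists2 e, e \in X &
      (v a \notin e) && ((v 1 \in e) || (v b \in e)).
    have hit : [|| [set v 1; v b] \in X, [set v 1; v c] \in X | [set v b; v c] \in X].
      by apply: triangle_cover_hits => //; apply: adjv; lia.
    by case/or3P: hit => eX; first [exists [set v 1; v b]; rewrite // !inE !neq; lia
            |exists [set v 1; v c]; rewrite // !inE !neq; lia
            |exists [set v b; v c]; rewrite // !inE !neq; lia].
  have sub : {subset [:: [set v a; v b]; e1; e2] <= enum X}.
    by move=> e; rewrite !inE mem_enum => /or3P[] /eqP->.
  have := uniq_leq_size _ sub; rewrite -cardE; apply.
  rewrite /= !inE negb_or andbT -andbA; apply/and3P; split.
  - by apply: contraNneq b1 => <-; rewrite set22.
  - by apply: contraNneq a2 => <-; rewrite set21.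
  - by apply: contraTneq ib2 => <-; rewrite negb_or i1.
have := triangle_cover_hits cX (adjv 2 3 isT isT isT) (adjv 2 4 isT isT isT) (adjv 3 4 isT isT isT).
case/or3P; [exact: (step 2 3 4) | exact: (step 2 4 3) | exact: (step 3 4 2)].
Qed.

Local Open Scope ring_scope.
Import Order.TTheory GRing.Theory Num.Theory.

Theorem theorem3 :
  (forall G : sgraph, complete_4partite G -> (5 <= #|[set: G]|)%N ->
     (tau G)%:R <= 3%:R / 2%:R * (nu G)%:R :> rat)
  /\
  (exists G : sgraph,
     [/\ complete_4partite G, #|[set: G]| = 5%N &
         (tau G)%:R = 3%:R / 2%:R * (nu G)%:R :> rat]).
Proof.
have bound G : complete_4partite G -> (5 <= #|[set: G]|)%N -> (2 * tau G <= 3 * nu G)%N.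
  move=> /complete_4partite_parts[p [p4 adjE ba cb /andP[d0 dc]]] n5.
  apply: (tau_le_nu p4 adjE) => //; apply: leq_trans n5 _.
  have -> : [set: G] = class p 0 :|: class p 1 :|: class p 2 :|: class p 3.
    by apply/setP => x; rewrite !inE; have := p4 x; lia.
  do 3![apply: leq_trans (leq_card_setU _ _) _; rewrite leq_add2r]; exact: leqnn.
split=> [G G4 n5|].
  have := bound G G4 n5; rewrite -(ler_nat rat) !natrM; lra.
have n5 : #|[set: k2111]| = 5%N by rewrite cardsT card_ord.
exists k2111; split=> //; first exact: k2111_4partite.
have := bound _ k2111_4partite; rewrite n5 => /(_ isT) le.
have t3 := k2111_tau; have n2 := k2111_nu.
(* 6 <= 2 tau <= 3 nu <= 6 forces both values. *)
have [-> ->] : tau k2111 = 3 /\ nu k2111 = 2 by lia.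
by rewrite mulfVK.
Qed.
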